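(* Let $p\in[1,\infty]$, let $q$ be the conjugate exponent of $p$ (so $\frac1p+\frac1q=1$), let $(\alpha_n)_{n=1}^\infty$ be a decreasing sequence of positive real numbers with $\alpha_n\to0$, and let $A=\{\alpha_ne_n:n\in\mathbb{N}\}\subset\ell_p$, where $e_n$ is the sequence whose $n$-th entry is $1$ and whose other entries are $0$. Then $$\tau(A)\ge\frac{q\,d_B(A)}{q+d_B(A)}.$$
   Context: For $p=\infty$ the space $\ell_p$ is understood to be $c_0$, the space of real sequences converging to zero with the supremum norm. ''Decreasing'' means $\alpha_{n+1}\le\alpha_n$ (ties allowed). The right-hand side is read as $\left(\frac1q+\frac1{d_B(A)}\right)^{-1}$ with the conventions $1/\infty=0$, $1/0=\infty$; in particular for $p=1$ ($q=\infty$) it equals $d_B(A)$. Box-counting dimension: $d_B(A)=\limsup_{\epsilon\to0}\frac{\log N(A,\epsilon)}{-\log\epsilon}$, where $N(A,\epsilon)$ is the minimum number of balls of radius $\epsilon$ with centres in $A$ required to cover $A$ (balls in $\ell_p$). For these sets it is known that $d_B(A)=\limsup_{n\to\infty}\frac{\log n}{-\log\alpha_n}$, so it is independent of $p$. Thickness exponent: $\tau(A)=\tau(A,\ell_p)=\limsup_{\epsilon\to0}\frac{\log d(A,\epsilon)}{-\log\epsilon}$, where $d(A,\epsilon)$ is the smallest dimension of those linear subspaces $V$ of $\ell_p$ that satisfy $\mathrm{dist}_{\ell_p}(x,V)\le\epsilon$ for all $x\in A$ (and $d(A,\epsilon)=\infty$ if no such finite-dimensional subspace exists). *)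

(* Defs.v *)
From HB Require Import structures.
From mathcomp Require Import all_boot all_order all_algebra.
From mathcomp Require Import all_classical all_reals all_analysis.

Set Implicit Arguments.
Unset Strict Implicit.
Unset Printing Implicit Defensive.

Import Order.TTheory GRing.Theory Num.Theory.
Import numFieldNormedType.Exports.

Local Open Scope classical_set_scope.
Local Open Scope ring_scope.

Section LittleLp.
Context {R : realType}.
Implicit Types (p : \bar R) (x y : nat -> R) (A V : set (nat -> R)) (eps : R).

(* The norm of l_p is the L^p norm for the counting measure on nat;
   for p = +oo it is the supremum norm. *)
Definition lp_norm p x : \bar R := 'N[@counting nat R]_p[EFin \o x].

(* By convention the space attached to p = +oo is c_0, not l_oo. *)
Definition lp p : set (nat -> R) :=
  [set x : nat -> R | x \in Lfun (@counting nat R) p /\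
    (p = +oo%E -> x @ \oo --> 0)].

Definition unit_seq (n : nat) : nat -> R := fun k => (k == n)%:R.

Definition lp_ball p x eps : set (nat -> R) :=
  [set y | lp p y /\ (lp_norm p (y - x)%R <= eps%:E)%E].

(* The value is +oo if no finite cover exists.  The centres [c i] need not be
   distinct, which does not affect the minimum. *)
Definition cover_number p A eps : \bar R :=
  ereal_inf [set n%:R%:E | n in [set n : nat |
    exists c : 'I_n -> (nat -> R),
      (forall i, A (c i)) /\ A `<=` \bigcup_i lp_ball p (c i) eps]].

Definition box_dim p A : \bar R :=
  limf_esup (fun eps => lne (cover_number p A eps) / - lne eps%:E)%E 0^'+.

Definition has_dim V (n : nat) : Prop :=
  exists b : 'I_n -> (nat -> R),
    (forall a : 'I_n -> R, \sum_i a i *: b i = 0 -> forall i, a i = 0) /\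
    V = [set \sum_i a i *: b i | a in [set: 'I_n -> R]].

Definition lp_dist p x V : \bar R :=
  ereal_inf [set lp_norm p (x - v) | v in V].

(* [has_dim V n] already makes V a linear subspace of sequences.  The value is
   +oo if no finite-dimensional V is admissible. *)
Definition approx_dim p A eps : \bar R :=
  ereal_inf [set n%:R%:E | n in [set n : nat |
    exists V, [/\ V `<=` lp p, has_dim V n &
      forall x, A x -> (lp_dist p x V <= eps%:E)%E]]].

Definition thickness p A : \bar R :=
  limf_esup (fun eps => lne (approx_dim p A eps) / - lne eps%:E)%E 0^'+.

End LittleLp.

(* Main.v *)
Require Import Defs.
From HB Require Import structures.
From mathcomp Require Import all_boot all_order all_algebra.
From mathcomp Require Import all_classical all_reals all_analysis.
From mathcomp Require Import finmap ess_sup_inf ring lra.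

(** If a subspace [V] of dimension [d] contains points [v_i] within [eps] of
    [alpha_i e_i] for [i < m], then by Hoelder's inequality the [m x m] matrix
    of the first [m] coordinates of the [v_i] has an off-diagonal part whose
    rows have l_1 norm at most [m^(1/q) eps].  When [m^(1/q) eps < alpha_i] the
    matrix is strictly diagonally dominant, hence invertible, and [d >= m].
    On the other hand [N(A, eps) <= m + 1] for the first [m] with
    [2 alpha_m <= eps], the tail being covered by the ball around
    [alpha_m e_m].  For this [m], the scale [eps' = eps / (4 m^(1/q))] gives
    [d(A, eps') >= m >= N(A, eps) - 1], and [- log eps'] exceeds [- log eps] by
    [(log m) / q + log 4]. *)

Set Implicit Arguments.
Unset Strict Implicit.
Unset Printing Implicit Defensive.

Import Order.TTheory GRing.Theory Num.Theory.
Import numFieldNormedType.Exports.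

Local Open Scope classical_set_scope.
Local Open Scope ring_scope.

(** If [u *m M = 0], then [d j * u j] is the [j]-th entry of [u] times the deviation of [M] from the
    diagonal matrix of [d]. Taking absolute values and summing over [j] gives [le], a sum of
    nonnegative terms whose second factors are positive, so [u = 0]. *)
Lemma row_strict_diag_dominant_row_free (F : realFieldType) (n : nat)
    (M : 'M[F]_n) (d : 'I_n -> F) :
  (forall i, \sum_j `|d i * (i == j)%:R - M i j| < d i) -> row_free M.
Proof.
move=> dom; apply/inj_row_free => u uM0.
have ud j : d j * u 0 j = \sum_i u 0 i * (d i * (i == j)%:R - M i j).
  under eq_bigr do rewrite mulrBr.
  rewrite sumrB [X in _ - X](_ : _ = (u *m M) 0 j); last by rewrite mxE.
  rewrite uM0 mxE subr0 (bigD1 j)//= eqxx mulr1 big1 ?addr0 1?mulrC// => i.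
  by move=> /negbTE ->; rewrite !mulr0.
have le : \sum_i `|u 0 i| * (d i - \sum_j `|d i * (i == j)%:R - M i j|) <= 0.
  under eq_bigr do rewrite mulrBr mulr_sumr.
  rewrite sumrB [X in _ - X]exchange_big/= -sumrB sumr_le0// => j _.
  rewrite subr_le0 -[leLHS]ger0_norm ?mulr_ge0//; last first.
    by rewrite (le_trans _ (ltW (dom j)))// sumr_ge0.
  rewrite normrM normr_id -normrM mulrC ud (le_trans (ler_norm_sum _ _ _))//.
  by apply: ler_sum => i _; rewrite normrM.
have pos i : 0 <= `|u 0 i| * (d i - \sum_j `|d i * (i == j)%:R - M i j|).
  by rewrite mulr_ge0// subr_ge0 ltW.
have /psumr_eq0P eq0 :
    \sum_i `|u 0 i| * (d i - \sum_j `|d i * (i == j)%:R - M i j|) = 0.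
  by apply/eqP; rewrite eq_le le sumr_ge0.
apply/rowP => i; rewrite mxE; apply/eqP.
have /eqP := eq0 (fun i _ => pos i) i erefl.
by rewrite mulf_eq0 normr_eq0 subr_eq0 [_ == \sum_j _]gt_eqF ?orbF.
Qed.

(** * Norms of sequences and Hoelder's inequality on initial segments *)

Section LpNorm.
Context {R : realType}.
Implicit Types (p : \bar R) (x y : nat -> R).

Lemma lp_norm_triangle p x y : (1 <= p)%E ->
  (lp_norm p (x + y)%R <= lp_norm p x + lp_norm p y)%E.
Proof. by move=> p1; rewrite /lp_norm; exact: eminkowski. Qed.

Lemma counting_gt0 (A : set nat) : A !=set0 -> (0 < @counting nat R A)%E.
Proof.
move=> [a Aa]; rewrite /counting; case: asboolP => [finA|_]; last exact: ltry.
rewrite lte_fin ltr0n lt0n cardfs_eq0; apply/negP => /eqP A0.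
by move: Aa; rewrite (fset_set_set0 finA A0).
Qed.

(** The only null set of the counting measure is the empty set. *)
Lemma ae_countingP (P : set nat) :
  {ae @counting nat R, forall n, P n} -> forall n, P n.
Proof.
move=> [N [_ N0 PN]] n; apply: contrapT => Pn.
by have := @counting_gt0 N (ex_intro _ n (PN _ Pn)); rewrite N0 ltxx.
Qed.

Lemma le_lp_normy x j : (`|x j|%:E <= lp_norm +oo x)%E.
Proof.
rewrite /lp_norm unlock ifT; last by apply: counting_gt0; exists 0%N.
exact: (ae_countingP (ess_sup_ge (@counting nat R) (abse \o (EFin \o x)))).
Qed.

Lemma lp_norm_finsupp (p : R) x m :
  0 < p -> (forall j, (m <= j)%N -> x j = 0) ->
  lp_norm p%:E x = ((\sum_(j < m) `|x j| `^ p) `^ p^-1)%:E.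
Proof.
move=> p0 x0; rewrite /lp_norm Lnorm_counting//.
rewrite (nneseries_split 0 m); last by move=> k _; exact: poweR_ge0.
rewrite add0n eseries0 ?adde0; last first.
  by move=> j mj _ /=; rewrite x0// normr0 powR0// gt_eqF.
by rewrite big_mkord sumEFin poweR_EFin.
Qed.

Lemma lp_norm_unit p (a : R) n : (1 <= p)%E ->
  (lp_norm p (a *: unit_seq n) <= `|a|%:E)%E.
Proof.
case: p => [p| |]//; rewrite ?lee_fin => p1.
  have p0 : 0 < p by rewrite (lt_le_trans _ p1).
  rewrite (@lp_norm_finsupp _ _ n.+1)//; last first.
    by move=> j nj; rewrite /unit_seq fctE gtn_eqF// scaler0.
  rewrite lee_fin big_ord_recr/= big1 ?add0r.
    rewrite /unit_seq !fctE eqxx /= /GRing.scale/= mulr1.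
    by rewrite -powRrM mulfV ?gt_eqF// powRr1.
  move=> j _; rewrite /unit_seq !fctE ltn_eqF// scaler0 normr0.
  by rewrite powR0// gt_eqF.
rewrite /lp_norm unlock; case: ifP => // _; apply/ess_supP/nearW => j /=.
rewrite /unit_seq !fctE lee_fin; case: eqP => _; last by rewrite scaler0 normr0.
by rewrite /GRing.scale/= mulr1.
Qed.

Lemma hoelder_partial_sum p (k : R) x m : (1 <= p)%E -> (p^-1 + k%:E = 1)%E ->
  ((\sum_(j < m) `|x j|)%:E <= (m%:R `^ k)%:E * lp_norm p x)%E.
Proof.
case: p => [p| |]//; last first.
  rewrite invey add0e => _ [->]; rewrite powRr1//.
  rewrite -[in leRHS](card_ord m) -sum1_card natr_sum -!sumEFin.
  rewrite ge0_sume_distrl; last by move=> *; rewrite lee_fin.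
  by apply: lee_sum => j _; rewrite mul1e; exact: le_lp_normy.
rewrite lee_fin => p1; have p0 : 0 < p by rewrite (lt_le_trans _ p1).
rewrite inver gt_eqF// => -[pk].
have [k0|k0] := eqVneq k 0.
  have {pk} -> : p = 1 by apply: invr_inj; rewrite invr1 -pk k0 addr0.
  rewrite k0 powRr0 mul1e /lp_norm Lnorm_counting// invr1 poweRe1; last first.
    by apply: nneseries_ge0 => *; exact: poweR_ge0.
  apply: le_trans (nneseries_lim_ge m _); last by move=> *; exact: poweR_ge0.
  rewrite big_mkord -sumEFin; apply: lee_sum => j _.
  by rewrite poweRe1.
have {}k0 : 0 < k.
  by rewrite lt_neqAle eq_sym k0 -(lerD2l p^-1) pk addr0 invf_le1.
pose g (j : nat) : R := (j < m)%N%:R.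
have := @hoelder _ _ R (@counting nat R) g x k^-1 p.
rewrite invr_gt0 invrK addrC -!/(lp_norm _ _) => /(_ _ _ k0 p0 pk).
rewrite (@lp_norm_finsupp k^-1 g m) ?invr_gt0//; last first.
  by move=> j mj; rewrite /g ltnNge mj.
rewrite (@lp_norm_finsupp 1 (g \* x)%R m) //; last first.
  by move=> j mj; rewrite /g/= ltnNge mj mul0r.
rewrite invr1 invrK powRr1; last by apply: sumr_ge0 => *; exact: powR_ge0.
under eq_bigr do rewrite powRr1// /g/= ltn_ord mul1r.
under [X in ((X `^ _)%:E * _)%E]eq_bigr do rewrite /g ltn_ord normr1 powR1.
by rewrite sumr_const card_ord; apply.
Qed.
End LpNorm.

(** * Upper limits at 0 from the right *)

Section LimfEsupAtRight.
Context {R : realType}.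
Implicit Types (f : R -> \bar R) (t : \bar R).
Local Open Scope ereal_scope.

Lemma lt_limf_esup_at_right0 f t d : t < limf_esup f 0^'+ -> (0 < d)%R ->
  exists2 x, (0 < x < d)%R & t < f x.
Proof.
move=> tf d0.
have : t < ereal_sup (f @` [set x | (0 < x < d)%R]).
  apply: lt_le_trans tf _; apply: ereal_inf_lbound.
  exists [set x | (0 < x < d)%R] => //.
  by near=> x => /=; apply/andP; split; near: x;
    [exact: nbhs_right_gt|exact: nbhs_right_lt].
by move=> /ereal_sup_gt[_ [x xd <-]]; exists x.
Unshelve. all: by end_near. Qed.

Lemma limf_esup_at_right0_ge f t :
  (forall d, (0 < d)%R -> exists2 x, (0 < x < d)%R & t <= f x) ->
  t <= limf_esup f 0^'+.
Proof.
move=> tf; apply: le_ereal_inf_tmp => _ [V [d d0 dV] <-].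
have [x /andP[x0 xd] tfx] := tf d d0.
apply: le_ereal_sup_tmp; exists (f x) => //; exists x => //.
by apply: dV => //=; rewrite sub0r normrN gtr0_norm.
Qed.

End LimfEsupAtRight.

(** * Approximating subspaces and covers of the set [A] *)

Section OrthogonalSequence.
Context {R : realType}.
Variables (p : \bar R) (p1 : (1 <= p)%E) (alpha : nat -> R).
Let A : set (nat -> R) := [set alpha n *: unit_seq n | n in [set: nat]].

Lemma lp_unit (a : R) n : lp p (a *: unit_seq n).
Proof.
split.
  rewrite inE; apply/andP; split; apply: mem_set => //.
  exact: le_lt_trans (lp_norm_unit a n p1) (ltry _).
move=> _; apply: cvg_near_cst; exists n.+1 => // j /= nj.
by rewrite /unit_seq fctE gtn_eqF// scaler0.
Qed.

(* The factor 2 is there because the infimum in [lp_dist] need not be attained. *)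
Lemma approx_dim_ge (k eps : R) m : (p^-1 + k%:E = 1)%E -> 0 < eps ->
  (forall i, (i < m)%N -> 2 * eps * m%:R `^ k < alpha i) ->
  (m%:R%:E <= approx_dim p A eps)%E.
Proof.
move=> pk eps0 big; apply: le_ereal_inf_tmp => _ [n [V [_ [b [_ ->]] dist]] <-].
rewrite lee_fin ler_nat.
have approx (i : 'I_m) : exists a : 'I_n -> R,
    (lp_norm p (alpha i *: unit_seq i - \sum_l a l *: b l)%R < (2 * eps)%:E)%E.
  have : (lp_dist p (alpha i *: unit_seq i)
      [set (\sum_i a i *: b i)%R | a in [set: 'I_n -> R]] < (2 * eps)%:E)%E.
    apply: le_lt_trans (dist _ _) _; first by exists (val i).
    by rewrite lte_fin; lra.
  by move=> /ereal_inf_lt[_ [_ [a _ <-] <-] ?]; exists a.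
have [a ha] := choice approx.
pose C := \matrix_(i < m, l < n) a i l.
pose B := \matrix_(l < n, j < m) b l j.
(* Row [i] of [C *m B] holds the first [m] coordinates of the approximant of the [i]-th point. The
   product factors through dimension [n], so rank [m] forces [m <= n]. *)
suff : row_free (C *m B).
  by move=> /eqP <-; rewrite (leq_trans (mxrankM_maxl _ _))// rank_leq_col.
apply: (@row_strict_diag_dominant_row_free _ _ _ (fun i => alpha i)) => i.
apply: le_lt_trans (big i (ltn_ord i)).
rewrite -lee_fin mulrC EFinM.
apply: le_trans (lee_wpmul2l _ (ltW (ha i))); last by rewrite lee_fin powR_ge0.
apply: le_trans (hoelder_partial_sum _ _ p1 pk).
rewrite lee_fin; apply: ler_sum => j _; rewrite mxE !fctE fct_sumE.
under eq_bigr do rewrite !mxE.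
by rewrite /unit_seq eq_sym.
Qed.

Lemma cover_number_ge1 eps : (1 <= cover_number p A eps)%E.
Proof.
apply: le_ereal_inf_tmp => _ [[|n] [c [_ cov]] <-]; last first.
  by rewrite lee_fin ler1n.
by have [[]] := cov (alpha 0 *: unit_seq 0) (ex_intro2 _ _ 0%N I erefl).
Qed.

Lemma cover_number_le (eps : R) m :
  (forall n, 0 < alpha n) -> nonincreasing_seq alpha ->
  0 < eps -> 2 * alpha m <= eps -> (cover_number p A eps <= m.+1%:R%:E)%E.
Proof.
move=> pos dec eps0 small; apply: ereal_inf_lbound; exists m.+1 => //.
exists (fun i : 'I_m.+1 => alpha i *: unit_seq i); split.
  by move=> i; exists (val i).
move=> _ [n _ <-]; have [nm|mn] := ltnP n m.+1.
  exists (Ordinal nm) => //; split; first exact: lp_unit.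
  rewrite /= subrr -(scale0r (unit_seq 0)).
  by rewrite (le_trans (lp_norm_unit _ _ p1))// normr0 lee_fin ltW.
(* For [n > m] the triangle inequality bounds the distance to the last centre by
   [alpha n + alpha m <= 2 * alpha m], whatever [p] is. *)
exists ord_max => //; split; first exact: lp_unit.
rewrite /= -scaleNr (le_trans (lp_norm_triangle _ _ p1))//.
rewrite (le_trans (leeD (lp_norm_unit _ _ p1) (lp_norm_unit _ _ p1)))//.
rewrite normrN !gtr0_norm// lee_fin.
by have := dec _ _ (ltnW mn); lra.
Qed.

End OrthogonalSequence.

Lemma gt_EFin_between {R : realType} (a : R) (b : \bar R) :
  (a%:E < b)%E -> exists2 c : R, a < c & (c%:E < b)%E.
Proof.
case: b => [b| |]// ab; last by exists (a + 1); rewrite ?ltry ?ltrDl.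
by exists ((a + b) / 2); move: ab; rewrite !lte_fin; lra.
Qed.

(** * Comparison of the two exponents *)

Section ThicknessLowerBound.
Context {R : realType}.
Variables (p : \bar R) (p1 : (1 <= p)%E) (k : R) (pk : (p^-1 + k%:E = 1)%E).
Variables (alpha : nat -> R) (pos : forall n, 0 < alpha n).
Hypotheses (dec : nonincreasing_seq alpha) (lim0 : alpha @ \oo --> 0).
Let A : set (nat -> R) := [set alpha n *: unit_seq n | n in [set: nat]].

Let oppe_lne_gt0 (x : R) : 0 < x < 1 ->
  exists2 l : R, 0 < l & (- lne x%:E)%E = l%:E.
Proof.
move=> /andP[x0 x1]; exists (- ln x); last by rewrite lne_EFin.
by rewrite oppr_gt0 ln_lt0// x0.
Qed.

Lemma box_dim_ge0 : (0 <= box_dim p A)%E.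
Proof.
apply: limf_esup_at_right0_ge => d d0.
have x01 : 0 < Num.min d 1 / 2 < 1 by rewrite /Num.min; case: ifP; lra.
exists (Num.min d 1 / 2); first by rewrite /Num.min; case: ifP; lra.
have [l l0 ->] := oppe_lne_gt0 x01.
by rewrite mule_ge0 ?lne_ge0 ?cover_number_ge1// inve_ge0 lee_fin ltW.
Qed.

Lemma thickness_ge0 : (0 <= thickness p A)%E.
Proof.
apply: limf_esup_at_right0_ge => d d0.
have := pos 0; set a := alpha 0 => a0.
(* Since [2 * e < a], one point of [A] already excludes the zero subspace, whose dimension would
   have logarithm -oo; [e < 1] makes the denominator positive. *)
pose e := Num.min d (Num.min a 1) / 3.
have [e0 ed ea e1] : [/\ 0 < e, e < d, 2 * e < a & e < 1].
  by rewrite /e /Num.min; case: ifP; case: ifP; split; lra.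
exists e; first by rewrite e0.
have /oppe_lne_gt0[l l0 ->] : 0 < e < 1 by rewrite e0.
rewrite mule_ge0// ?inve_ge0 ?lee_fin ?(ltW l0)// lne_ge0.
apply: (approx_dim_ge (m := 1) p1 pk e0) => -[|//] _.
by rewrite powR1 mulr1.
Qed.

Let k_ge0 : 0 <= k.
Proof.
move: p1 pk; case: p => [r| |]//; last by rewrite invey add0e => _ [->].
rewrite lee_fin => r1; have r0 : 0 < r by rewrite (lt_le_trans _ r1).
rewrite inver gt_eqF// => -[rk].
by rewrite -(lerD2l r^-1) rk addr0 invf_le1.
Qed.

Lemma EFin_le_thickness (t : R) : 0 < t ->
  (t%:E < (k%:E + (box_dim p A)^-1)^-1)%E -> (t%:E <= thickness p A)%E.
Proof.
move=> t0; rewrite inve_pgt ?inE ?lee_fin ?(ltW t0)//; last first.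
  by apply: adde_ge0; rewrite ?lee_fin ?inve_ge0 ?box_dim_ge0 ?k_ge0.
rewrite inver gt_eqF// -lteBrDl// => dim.
(* The hypothesis on [t] now says that [u^-1] lies below the box dimension. A real [s] strictly
   between them satisfies [s * u > 1], which leaves room to absorb constants. *)
pose u := t^-1 - k.
have u0 : 0 < u.
  by rewrite -lte_fin EFinB (le_lt_trans _ dim)// inve_ge0 box_dim_ge0.
move: dim; rewrite -EFinB -/u inve_plt ?inE ?box_dim_ge0 ?lee_fin ?(ltW u0)//.
rewrite inver gt_eqF// => /gt_EFin_between[s us sD].
have su : 1 < s * u by rewrite -ltr_pdivrMr// div1r.
have tk : t * k = 1 - t * u by rewrite /u; field; rewrite gt_eqF.
have c0 : 0 < t * u by rewrite mulr_gt0.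
(* [L0] solves [t * L + t * ln 4 = t * u * (s * L - ln 2)] for [L]; beyond it the right side is the
   larger one. *)
pose L0 := (t * ln 4 + t * u * ln 2) / (t * (s * u - 1)).
apply: limf_esup_at_right0_ge => d d0.
pose d' := Num.min d (Num.min 1 (expR (- L0))).
have d'0 : 0 < d' by rewrite !lt_min d0 ltr01 expR_gt0.
have [e /andP[e0 +] +] := lt_limf_esup_at_right0 sD d'0.
rewrite !lt_min => /and3P[ed e1 eL].
rewrite lne_EFin// -EFinN inver gt_eqF; last by rewrite oppr_gt0 ln_lt0 ?e0.
set L := - ln e => sN.
have L0L : L0 < L by rewrite ltrNr -[- L0]expRK ltr_ln ?posrE ?expR_gt0.
have Lgt0 : 0 < L by rewrite /L oppr_gt0 ln_lt0 ?e0.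
have [m em mmin] : exists2 m, 2 * alpha m <= e &
    forall i, (i < m)%N -> e < 2 * alpha i.
  have ex : exists m, 2 * alpha m <= e.
    have e2 : 0 < e / 2 by rewrite divr_gt0.
    have [n _ /(_ n (leqnn n))/= an] := cvgr_lt _ lim0 _ e2.
    by exists n; lra.
  case: (ex_minnP ex) => m em min; exists m => // i im.
  by rewrite ltNge; apply/negP => /min; rewrite leqNgt im.
have {}sN : s * L < ln m.+1%:R.
  move: sN; rewrite lte_pdivlMr// => /lt_le_trans.
  rewrite -lte_fin -(lne_EFin (r := m.+1%:R))//; apply.
  rewrite lee_lne ?(cover_number_le p1 pos dec e0 em)//;
    rewrite in_itv/= leey andbT.
    by rewrite (le_trans _ (cover_number_ge1 p alpha e)).
  by rewrite lee_fin.
have s0 : 0 < s by rewrite (lt_trans _ us)// invr_gt0.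
(* For [m = 0] the bound on [ln m.+1%:R] would read [s * L < 0]. *)
have m0 : (0 < m)%N.
  rewrite lt0n; apply: contraTneq sN => ->; rewrite ln1 -leNgt.
  by rewrite mulr_ge0 ?ltW.
have m0' : 0 < m%:R :> R by rewrite ltr0n.
(* Passing from [m + 1] to [m] costs [ln 2], because [m + 1 <= 2 * m]. *)
have lnm : s * L - ln 2 <= ln m%:R.
  rewrite lerBlDr -lnM ?posrE// (le_trans (ltW sN))// ler_ln ?posrE ?mulr_gt0//.
  by rewrite -natrM ler_nat muln2 -addnn -addn1 leq_add2l.
have mk1 : 1 <= m%:R `^ k by rewrite -[leLHS](powRr0 m%:R) ler_powR// ler1n.
have mk0 : 0 < m%:R `^ k by rewrite powR_gt0.
pose e' := e / (4 * m%:R `^ k).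
have e'0 : 0 < e' by rewrite divr_gt0// mulr_gt0.
have e'e : e' < e.
  by rewrite ltr_pdivrMr ?mulr_gt0// ltr_pMr//; lra.
exists e'; first by rewrite e'0 (lt_trans e'e ed).
have lne' : - ln e' = L + ln 4 + k * ln m%:R.
  by rewrite ln_div ?posrE ?mulr_gt0// lnM ?posrE// ln_powR /L; ring.
rewrite lne_EFin// -EFinN inver.
have l'0 : 0 < - ln e' by rewrite oppr_gt0 ln_lt0// e'0 (lt_trans e'e).
rewrite gt_eqF// lee_pdivlMr//.
have mA : (m%:R%:E <= approx_dim p A e')%E.
  apply: (approx_dim_ge p1 pk e'0) => i /mmin; rewrite /e'.
  rewrite (_ : 2 * _ * _ = e / 2); first by lra.
  by field; rewrite gt_eqF.
apply: (@le_trans _ _ (lne m%:R%:E)); last first.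
  rewrite lee_lne// in_itv/= leey andbT ?lee_fin ?ler0n//.
  by rewrite (le_trans _ mA) ?lee_fin.
rewrite lne_EFin// lee_fin lne'.
(* As [t * k = 1 - t * u], the goal amounts to [t * L + t * ln 4 <= t * u * ln m%:R], which follows
   from [lnm] and the choice of [L0]. *)
move: L0L; rewrite /L0 ltr_pdivrMr ?mulr_gt0 ?subr_gt0// => L0L.
have umul : t * u * (s * L - ln 2) <= t * u * ln m%:R by rewrite ler_pM2l.
rewrite [leLHS](_ : _ = t * L + t * ln 4 + t * k * ln m%:R); last by ring.
rewrite tk; lra.
Qed.

(** Otherwise some real [t] lies strictly between the two sides; it is positive by [thickness_ge0],
    so [EFin_le_thickness] gives a contradiction. *)
Lemma thickness_ge : ((k%:E + (box_dim p A)^-1)^-1 <= thickness p A)%E.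
Proof.
rewrite leNgt; apply/negP => lt.
have := thickness_ge0; case: (thickness p A) lt EFin_le_thickness => [h| |]//.
  rewrite lee_fin => /gt_EFin_between[t ht tX] gt h0.
  by have := gt t (le_lt_trans h0 ht) tX; rewrite lee_fin leNgt ht.
by rewrite ltNge leey.
Qed.

End ThicknessLowerBound.

Theorem lemma4p9 (R : realType) (p q : \bar R)
  (hp : (1 <= p)%E) (hpq : (p^-1 + q^-1 = 1)%E)
  (alpha : nat -> R)
  (alpha_pos : forall n, 0 < alpha n)
  (alpha_dec : nonincreasing_seq alpha)
  (alpha_lim : alpha @ \oo --> 0)
  (A : set (nat -> R))
  (hA : A = [set alpha n *: unit_seq n | n in [set: nat]]) :
  ((q^-1 + (box_dim p A)^-1)^-1 <= thickness p A)%E.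
Proof.
have pfin : p^-1%E \is a fin_num.
  case: p hp {hpq} => [r| |]// r1; rewrite inver gt_eqF//.
  by move: r1; rewrite lee_fin; exact: lt_le_trans.
(* As 1/p is finite, the conjugacy relation forces 1/q to be a real number; [q = +oo] corresponds to
   [k = 0]. *)
have [k qk] : exists k, q^-1%E = k%:E.
  move: hpq; case: q^-1%E => [k _| |]; first by exists k.
    by rewrite addey//; move: pfin; rewrite fin_numE => /andP[].
  by rewrite addeNy.
by rewrite hA qk; apply: thickness_ge => //; rewrite -qk.
Qed.
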